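(* Let $\Lambda$, $A$ and $B$ be closed subsets of $\mathbb{E}$, let $\bar x\in A\cap B\cap\Lambda$, and let $n\in\mathbb{N}$ with $n\ge1$ and $c\in[0,1)$ be fixed. Suppose that there is $\rho>0$ such that every alternating projections sequence $(x_k)_{k\in\mathbb{N}}$ (with associated sequence $(b_k)_{k\in\mathbb{N}}$) starting at a point $x_0\in A\cap\Lambda$ with $\|x_0-\bar x\|<\rho$ has a subsequence of the form $(x_{j+nk})_{k\in\mathbb{N}}$ for some $j\in\{0,1,\ldots,n-1\}$ such that the (shifted) joining sequence $(z_{2j+k})_{k\in\mathbb{N}}$, where $z_{2k}=x_k$ and $z_{2k+1}=b_k$, is a linear extension of $(x_{j+nk})_{k\in\mathbb{N}}$ on $\Lambda$ with frequency $2n$ and rate $c$. Then the collection of sets $\{A,B\}$ is subtransversal at $\bar x$ relative to $\Lambda$ with constant $$\mathrm{sr}'[A,B](\bar x)\le\frac{2\big(2n-1-c(n-1)\big)}{1-c}.$$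
   Context: $\mathbb{E}$ is a Euclidean space; $\operatorname{dist}(x,C):=\inf_{a\in C}\|x-a\|$; $\mathbb{B}_\delta(x)$ is the open ball. The projector onto a closed set $C$ is $P_Cx:=\operatorname{argmin}_{a\in C}\|a-x\|$ (set-valued). Alternating projections: a sequence $(x_k)$ with $x_{k+1}\in P_AP_Bx_k$ for all $k\in\mathbb{N}$, together with an associated sequence $(b_k)$ in $B$ such that $b_k\in P_Bx_k$ and $x_{k+1}\in P_Ab_k$ for all $k$. Linear extension: a sequence $(w_k)_{k\in\mathbb{N}}$ on $\Lambda$ is a linear extension on $\Lambda$ of a sequence $(y_k)_{k\in\mathbb{N}}$ on $\Lambda$ with frequency $m\ge1$ and rate $c\in[0,1)$ if $y_k=w_{mk}$ for all $k$ and, for all $k\in\mathbb{N}$, $\|w_{k+2}-w_{k+1}\|\le\|w_{k+1}-w_k\|$ and $\|w_{m(k+1)+1}-w_{m(k+1)}\|\le c\|w_{mk+1}-w_{mk}\|$. Subtransversality (at a common point): $\{A,B\}$ is subtransversal at $\bar x\in A\cap B$ relative to $\Lambda$ if there are $\delta>0$, $\kappa\ge0$ with $\operatorname{dist}(x,A\cap B\cap\Lambda)\le\kappa\max\{\operatorname{dist}(x,A),\operatorname{dist}(x,B)\}$ for all $x\in\mathbb{B}_\delta(\bar x)\cap\Lambda$. Equivalently, there are $\delta>0$, $\kappa\ge0$ with $$\operatorname{dist}(x,A\cap B\cap\Lambda)\le\kappa\operatorname{dist}(x,B)\quad\forall x\in A\cap\mathbb{B}_\delta(\bar x)\cap\Lambda;\qquad(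 * )$$ $\mathrm{sr}'[A,B](\bar x)$ denotes the infimum of all $\kappa\ge0$ for which $( * )$ holds for some $\delta>0$.
   Formalization: Subtransversality is proved in form ( * ), for x in A∩Λ near x̄; the max form over all x in Λ near x̄ is not equivalent for general Λ and can fail (A=B={(t,t²)}, Λ={(t,0)}, x̄=0), but it follows from ( * ) when A⊆Λ. *)

(* Defs.v *)
From HB Require Import structures.
From mathcomp Require Import all_boot all_order all_algebra.
From mathcomp Require Import all_classical all_reals all_analysis.
From mathcomp Require Import ring lra.

Set Implicit Arguments.
Unset Strict Implicit.
Unset Printing Implicit Defensive.

Import Order.TTheory GRing.Theory Num.Theory.
Import numFieldNormedType.Exports.

Local Open Scope classical_set_scope.
Local Open Scope ring_scope.

(* The Euclidean space is 'rV[R]_d. The library norm `|x| on row vectors is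
   the sup norm; it induces the same topology, so the library predicate
   [closed] is used, but every metric notion below is built on [enorm]. *)
Section Euclidean.
Variables (R : realType) (d : nat).
Implicit Types (A B C Lambda : set 'rV[R]_d) (x y xbar : 'rV[R]_d).

Definition enorm x : R := Num.sqrt (\sum_(i < d) x ord0 i ^+ 2).

Definition eball xbar (delta : R) : set 'rV[R]_d :=
  [set x | enorm (x - xbar) < delta].

(* [inf] is real-valued, with junk value 0 on the empty set; all the sets whose
   distance function is used below contain the reference point. *)
Definition dist x C : R := inf [set enorm (x - a) | a in C].

Definition projector C x : set 'rV[R]_d :=
  [set a | C a /\ forall a', C a' -> enorm (a - x) <= enorm (a' - x)].

Definition alternating_projections A B (x b : nat -> 'rV[R]_d) : Prop :=
  forall k, projector B (x k) (b k) /\ projector A (b k) (x k.+1).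

Definition joining (x b : nat -> 'rV[R]_d) (k : nat) : 'rV[R]_d :=
  if odd k then b k./2 else x k./2.

Definition linear_extension Lambda (w y : nat -> 'rV[R]_d) (m : nat) (c : R)
    : Prop :=
  [/\ (1 <= m)%N /\ 0 <= c < 1,
      (forall k, Lambda (w k)) /\ (forall k, Lambda (y k)),
      forall k, y k = w (m * k)%N,
      forall k, enorm (w k.+2 - w k.+1) <= enorm (w k.+1 - w k)
    & forall k, enorm (w (m * k.+1).+1 - w (m * k.+1)%N)
                <= c * enorm (w (m * k).+1 - w (m * k)%N)].

Definition subtransversal_ineq Lambda A B xbar (kappa : R) : Prop :=
  exists2 delta : R, 0 < delta &
    forall x, A x -> eball xbar delta x -> Lambda x ->
      dist x (A `&` B `&` Lambda) <= kappa * dist x B.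

Definition subtransversal Lambda A B xbar : Prop :=
  exists2 kappa : R, 0 <= kappa & subtransversal_ineq Lambda A B xbar kappa.

(* Extended-real infimum, so that it is +oo when no constant kappa exists. *)
Definition sr' Lambda A B xbar : \bar R :=
  ereal_inf [set kappa%:E | kappa in
    [set kappa : R | 0 <= kappa /\ subtransversal_ineq Lambda A B xbar kappa]].

(* The variant of subtransversality in which x ranges over all of
   [eball xbar delta `&` Lambda]. It always implies [subtransversal], and the
   two are equivalent when A `<=` Lambda, in particular when Lambda = setT
   ([subtransversal_maxP]). For an arbitrary closed Lambda it is strictly
   stronger: take A = B = {(t, t^2)}, Lambda = {(t, 0)} and xbar = (0, 0); then
   A `&` Lambda = {xbar}, whereas dist (t, 0) A <= t^2 and the distance from
   (t, 0) to A `&` B `&` Lambda is |t|. *)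
Definition subtransversal_max Lambda A B xbar : Prop :=
  exists2 kappa : R, 0 <= kappa & exists2 delta : R, 0 < delta &
    forall x, eball xbar delta x -> Lambda x ->
      dist x (A `&` B `&` Lambda) <= kappa * Num.max (dist x A) (dist x B).

Lemma enorm_ge0 x : 0 <= enorm x.
Proof. exact: sqrtr_ge0. Qed.

Lemma enorm0 : enorm 0 = 0.
Proof. by rewrite /enorm big1 ?sqrtr0// => i _; rewrite mxE expr0n. Qed.

Lemma enormN x : enorm (- x) = enorm x.
Proof. by congr Num.sqrt; apply: eq_bigr => i _; rewrite mxE sqrrN. Qed.

Lemma enorm_distC x y : enorm (x - y) = enorm (y - x).
Proof. by rewrite -enormN opprB. Qed.

Lemma sqr_enorm x : enorm x ^+ 2 = \sum_(i < d) x ord0 i ^+ 2.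
Proof. by rewrite sqr_sqrtr// sumr_ge0// => i _; exact: sqr_ge0. Qed.

Lemma dot_le_enorm x y :
  \sum_(i < d) x ord0 i * y ord0 i <= enorm x * enorm y.
Proof.
set s := \sum_(i < d) _.
have q (t u : R) : 0 <= t ^+ 2 * enorm x ^+ 2 - 2 * (t * u) * s
                        + u ^+ 2 * enorm y ^+ 2.
  have -> : t ^+ 2 * enorm x ^+ 2 - 2 * (t * u) * s + u ^+ 2 * enorm y ^+ 2 =
      \sum_(i < d) (t * x ord0 i - u * y ord0 i) ^+ 2.
    rewrite !sqr_enorm !mulr_sumr -sumrB -big_split /=.
    by apply: eq_bigr => i _; ring.
  by apply: sumr_ge0 => i _; exact: sqr_ge0.
have x0 := enorm_ge0 x; have y0 := enorm_ge0 y.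
have [xy0|xy0] := eqVneq (enorm x * enorm y) 0; last first.
  have xy : 0 < enorm x * enorm y by rewrite lt0r xy0 mulr_ge0.
  have := q (enorm y) (enorm x); nra.
rewrite xy0; have /orP[/eqP e|/eqP e] : (enorm x == 0) || (enorm y == 0).
- by rewrite -mulf_eq0 xy0.
- by have := q ((enorm y ^+ 2 + 1) / 2) s; rewrite e; nra.
- by have := q s ((enorm x ^+ 2 + 1) / 2); rewrite e; nra.
Qed.

Lemma enormD x y : enorm (x + y) <= enorm x + enorm y.
Proof.
have x0 := enorm_ge0 x; have y0 := enorm_ge0 y.
rewrite -(@ler_pXn2r _ 2)// ?nnegrE ?addr_ge0 ?enorm_ge0//.
have := dot_le_enorm x y; have := sqr_enorm x; have := sqr_enorm y.
rewrite (sqr_enorm (x + y)).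
have -> : \sum_(i < d) (x + y) ord0 i ^+ 2 = \sum_(i < d) x ord0 i ^+ 2
   + 2 * (\sum_(i < d) x ord0 i * y ord0 i) + \sum_(i < d) y ord0 i ^+ 2.
  rewrite mulr_sumr -!big_split /=; apply: eq_bigr => i _.
  by rewrite mxE; ring.
by move=> <- <-; nra.
Qed.

Lemma enorm_triangle x y z : enorm (x - z) <= enorm (x - y) + enorm (y - z).
Proof. by rewrite -[x - z](subrKA y) enormD. Qed.

Lemma dist_le x C a : C a -> dist x C <= enorm (x - a).
Proof.
move=> Ca; apply: ge_inf; last by exists a.
by exists 0 => _ [b _ <-]; exact: enorm_ge0.
Qed.

Lemma dist_approx x C (e : R) : C !=set0 -> 0 < e ->
  exists2 a, C a & enorm (x - a) < dist x C + e.
Proof.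
move=> [c Cc] e0.
have hi : has_inf [set enorm (x - a) | a in C].
  split; first by exists (enorm (x - c)), c.
  by exists 0 => _ [b _ <-]; exact: enorm_ge0.
by have [_ [a Ca <-] lta] := inf_adherent e0 hi; exists a.
Qed.

Lemma dist_ge0 x C : 0 <= dist x C.
Proof.
have [->|C0] := eqVneq C set0; first by rewrite /dist image_set0 inf0.
by apply: lb_le_inf; [exact/image_nonempty/set0P|
  move=> _ [b _ <-]; exact: enorm_ge0].
Qed.

Lemma dist_lip x y C : C !=set0 -> dist x C <= enorm (x - y) + dist y C.
Proof.
move=> C0; apply/ler_addgt0Pr => e e0.
have [a Ca lta] := dist_approx y C0 e0.
have := dist_le x Ca; have := enorm_triangle x y a; lra.
Qed.

Lemma subtransversal_maxW Lambda A B xbar :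
  subtransversal_max Lambda A B xbar -> subtransversal Lambda A B xbar.
Proof.
move=> [k k0 [r r0 H]]; exists k => //; exists r => // x Ax rx Lx.
apply: le_trans (H x rx Lx) _; rewrite ler_wpM2l// ge_max lexx andbT.
by apply: le_trans (dist_le x Ax) _; rewrite subrr enorm0 dist_ge0.
Qed.

Lemma subtransversal_maxP Lambda A B xbar :
  A `<=` Lambda -> (A `&` B `&` Lambda) xbar ->
  subtransversal Lambda A B xbar <-> subtransversal_max Lambda A B xbar.
Proof.
move=> AL [[Ax Bx] Lx]; split; last exact: subtransversal_maxW.
move=> [k k0 [r r0 H]]; exists (1 + 2 * k); first by lra.
exists (r / 4); first by lra.
move=> y; rewrite /eball /= => yr Ly; apply/ler_addgt0Pr => e e0.
set f := Num.min (e / (1 + k)) (r / 4).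
have k1 : 0 < 1 + k by lra.
have f0 : 0 < f by rewrite lt_min !divr_gt0.
have fe : (1 + k) * f <= e.
  by rewrite mulrC -ler_pdivlMr// ge_min lexx.
have fr : f <= r / 4 by rewrite ge_min lexx orbT.
have A0 : A !=set0 by exists xbar.
have B0 : B !=set0 by exists xbar.
have S0 : (A `&` B `&` Lambda) !=set0 by exists xbar.
have [a Aa ya] := dist_approx y A0 f0.
have yA := dist_le y Ax.
have ar : enorm (a - xbar) < r.
  have := enorm_triangle a y xbar; rewrite (enorm_distC a y); lra.
have h1 := H a Aa ar (AL _ Aa).
have h2 := dist_lip y a S0.
have h3 := dist_lip a y B0; rewrite (enorm_distC a y) in h3.
set M := Num.max _ _.
have MA : dist y A <= M by rewrite le_max lexx.
have MB : dist y B <= M by rewrite le_max lexx orbT.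
have h4 : k * dist a B <= k * (2 * M + f) by rewrite ler_wpM2l//; lra.
nra.
Qed.

End Euclidean.

(* Main.v *)
Require Import Defs.
From mathcomp Require Import all_boot all_order all_algebra.
From mathcomp Require Import all_classical all_reals all_analysis.
From mathcomp Require Import lra.
Import Order.TTheory GRing.Theory Num.Theory.
Import numFieldNormedType.Exports.
Local Open Scope classical_set_scope.
Local Open Scope ring_scope.

(** Start alternating projections at a point [x 0] of [A] and [Lambda] close to
    [xbar]. The bound to be proved compares the distance from [x 0] to the
    common points with the length of the first step, since
    [enorm (b 0 - x 0) = dist (x 0) B]. It therefore suffices that the
    polygonal path through the joining sequence has length at most
    [kappa * enorm (b 0 - x 0)]: a path of finite length converges
    ([cvg_of_finite_length]), its limit lies in [A] and [B] because the even
    terms lie in [A] and the odd terms in [B] ([joining_cvg]), it lies in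
    [Lambda] because a tail of the sequence does, and it is no farther from
    [x 0] than the length of the path.

    The length is estimated in two parts ([joining_length_le]). Projecting
    never lengthens a step ([joining_step_decr]), so each of the first [2 * j]
    steps is at most the first one; with [j <= n - 1] they contribute at most
    [2 * (n - 1)] first steps. From index [2 * j] on, the steps are split into
    blocks of [2 * n] whose leading terms decay geometrically with rate [c], so
    they contribute at most [2 * n / (1 - c)] first steps
    ([sum_geometric_blocks]). The sum
    [2 * (n - 1) + 2 * n / (1 - c)] is the announced constant.

    Such sequences exist from every starting point, because projections onto
    nonempty closed sets exist in finite dimension ([projector_nonempty]). *)

(** * Projections and convergence in Euclidean space *)

Section Euclidean.
Context {R : realType} {d : nat}.
Implicit Types (C : set 'rV[R]_d) (x y : 'rV[R]_d) (z : nat -> 'rV[R]_d).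

Lemma coord_le_enorm x i : `|x ord0 i| <= enorm x.
Proof.
rewrite -sqrtr_sqr /enorm ler_wsqrtr// (bigD1 i)//= lerDl.
by apply: sumr_ge0 => j _; exact: sqr_ge0.
Qed.

Lemma enorm_lt_ball x y (e : R) : enorm (x - y) < e -> ball x e y.
Proof.
move=> xy; split; first exact: le_lt_trans (enorm_ge0 _) xy.
move=> i j; rewrite /ball /= (ord1 i).
by apply: le_lt_trans xy; have := coord_le_enorm (x - y) j; rewrite !mxE.
Qed.

(** The topology is that of the sup norm, so continuity is read off from the
    coordinates. *)
Lemma continuous_enormB y : continuous (fun x => enorm (x - y)).
Proof.
have -> : (fun x => enorm (x - y)) =
    Num.sqrt \o (fun x => \sum_(i < d) (x ord0 i - y ord0 i) ^+ 2).
  by apply/funext => x /=; congr Num.sqrt; apply: eq_bigr => i _; rewrite !mxE.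
move=> x; apply: continuous_comp; last exact: sqrt_continuous.
move: x; apply: continuous_big => [p|i _ x].
  by apply: cvgD; [exact: cvg_fst|exact: cvg_snd].
apply: (@continuous_comp _ _ _ (fun x => x ord0 i - y ord0 i)
  (fun t : R => t ^+ 2)); last exact: exprn_continuous.
apply: (@cvgB R R^o _ (nbhs x) _ (fun x => x ord0 i)).
  exact: coord_continuous.
exact: cvg_cst.
Qed.

Lemma closed_enorm_le y (r : R) : closed [set x | enorm (x - y) <= r].
Proof.
apply: (@closed_comp _ _ (fun x => enorm (x - y)) [set t | t <= r]).
  by move=> x _; exact: continuous_enormB.
exact: closed_le.
Qed.

(** Only the part of [C] no farther from [x] than some given point of [C]
    matters, and that part is compact. *)
Lemma projector_nonempty C x : closed C -> C !=set0 -> projector C x !=set0.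
Proof.
move=> Ccl [a Ca]; set r := enorm (a - x).
pose D := C `&` [set y | enorm (y - x) <= r].
have Dco : compact D.
  apply: bounded_closed_compact; last exact: closedI Ccl (closed_enorm_le x r).
  exists (r + enorm x); split; first exact: num_real.
  move=> M rM y [_ /= yr]; rewrite /Num.norm /= mx_normrE.
  have y0 : enorm y <= r + enorm x.
    by have := enormD (y - x) x; rewrite subrK; lra.
  apply/bigmax_leP; split => [|[i j] _ /=].
    by apply: le_trans (ltW rM); exact: le_trans (enorm_ge0 y) y0.
  by rewrite (ord1 i); have := coord_le_enorm y j; lra.
have D0 : D !=set0 by exists a; split => //=.
have Dcont : {within D, continuous (fun y => enorm (y - x))}.
  exact: continuous_subspaceT (continuous_enormB x).
have [p /set_mem [Cp pr] pmin] := compact_EVT_min D0 Dco Dcont.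
exists p; split => // q Cq; have [qr|rq] := leP (enorm (q - x)) r.
  by apply: pmin; exact/mem_set.
exact: le_trans pr (ltW rq).
Qed.

Lemma projector_le_dist C x p : projector C x p -> enorm (p - x) <= dist x C.
Proof.
move=> [Cp pmin]; apply: lb_le_inf; first by exists (enorm (x - p)), p.
by move=> _ [a Ca <-]; rewrite (enorm_distC x) pmin.
Qed.

(** The partial lengths increase to their supremum, so beyond some [N] less
    than [e] of the length remains: this makes the sequence Cauchy. *)
Lemma cvg_of_finite_length z (K : R) :
  (forall N, \sum_(i < N) enorm (z i.+1 - z i) <= K) ->
  exists2 l : 'rV[R]_d, z @ \oo --> l & enorm (z 0%N - l) <= K.
Proof.
move=> zK; pose S N := \sum_(i < N) enorm (z i.+1 - z i).
have zS N k : enorm (z (N + k)%N - z N) <= S (N + k)%N - S N.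
  elim: k => [|k IHk]; first by rewrite addn0 !subrr enorm0.
  rewrite addnS [S _.+1]big_ord_recr /= -/(S (N + k)%N).
  by have := enorm_triangle (z (N + k).+1) (z (N + k)%N) (z N); lra.
have zc : cvg (z @ \oo).
  apply/cauchy_cvgP/cauchy_exP => e e0.
  have hS : has_sup (range S).
    by split; [exists (S 0%N), 0%N|exists K => _ [N _ <-]; exact: zK].
  have [_ [N _ <-] SN] := sup_adherent e0 hS.
  exists (z N), N => // k /= Nk; apply: enorm_lt_ball; rewrite enorm_distC.
  have := zS N (k - N)%N; rewrite subnKC//.
  have := ub_le_sup (proj2 hS) (imageT S k); lra.
exists (lim (z @ \oo)) => //; rewrite enorm_distC.
apply: (closed_cvg _ (closed_enorm_le (z 0%N) K)) zc.
apply: nearW => k /=; have := zS 0%N k; rewrite add0n.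
by have := zK k; rewrite -/(S k) /S big_ord0; lra.
Qed.

End Euclidean.

(** * Monotone sequences with geometric decay along a subsequence *)

(** Monotonicity bounds the block of [m] terms starting at [m * k] by
    [m * u (m * k)], and these bounds form a geometrically dominated series. *)
Lemma sum_geometric_blocks {R : realFieldType} (u : nat -> R) (m : nat)
    (c : R) :
  (0 < m)%N -> (forall k, 0 <= u k) -> (forall k, u k.+1 <= u k) ->
  (forall k, u (m * k.+1)%N <= c * u (m * k)%N) -> c <= 1 ->
  forall N, (1 - c) * \sum_(i < N) u i <= m%:R * u 0%N.
Proof.
move=> m0 u0 udecr uc c1 N.
have ule i k : u (i + k)%N <= u i.
  by elim: k => [|k IHk]; rewrite ?addn0// addnS (le_trans (udecr _)).
(* The second summand bounds what all later blocks can still add; keeping it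
   makes the estimate telescope. *)
have blocks k : (1 - c) * (\sum_(i < m * k) u i) + m%:R * u (m * k)%N
    <= m%:R * u 0%N.
  elim: k => [|k IHk]; first by rewrite muln0 big_ord0 mulr0 add0r.
  have blk : \sum_(i < m) u (m * k + i)%N <= m%:R * u (m * k)%N.
    rewrite -[m in m%:R]card_ord mulr_natl -sumr_const.
    by apply: ler_sum => i _; exact: ule.
  have := uc k; rewrite mulnS [(m + _)%N]addnC big_split_ord /= => uck.
  have := ler_wpM2l (ler0n R m) uck.
  have c1' : 0 <= 1 - c by lra.
  have := ler_wpM2l c1' blk; nra.
have NmN : (N <= m * N)%N by exact: leq_pmull.
apply: le_trans (blocks N); rewrite -(subnKC NmN) big_split_ord /=.
rewrite mulrDr -addrA lerDl addr_ge0 ?mulr_ge0 ?sumr_ge0 ?ler0n//; lra.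
Qed.

(** * The joining sequence of alternating projections *)

Section AlternatingProjections.
Context {R : realType} {d : nat}.
Implicit Types (A B : set 'rV[R]_d) (x b : nat -> 'rV[R]_d).

Lemma alternating_projections_exists A B (x0 : 'rV[R]_d) :
  closed A -> closed B -> A !=set0 -> B !=set0 ->
  exists x b, x 0%N = x0 /\ alternating_projections A B x b.
Proof.
move=> Acl Bcl A0 B0.
have [pA pAP] := choice (fun y => projector_nonempty A y Acl A0).
have [pB pBP] := choice (fun y => projector_nonempty B y Bcl B0).
exists (fun k => iter k (pA \o pB) x0), (fun k => pB (iter k (pA \o pB) x0)).
by split.
Qed.

Lemma joining_even x b k : joining x b (k.*2) = x k.
Proof. by rewrite /joining odd_double doubleK. Qed.

Lemma joining_odd x b k : joining x b (k.*2).+1 = b k.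
Proof. by rewrite /joining /= odd_double uphalf_double. Qed.

Lemma alternating_projections_in A B x b :
  alternating_projections A B x b -> A (x 0%N) -> forall k, A (x k) /\ B (b k).
Proof.
move=> xb A0 k; split; last by case: (xb k) => -[].
by case: k => // k; case: (xb k) => _ [].
Qed.

(** The point projected next is at least as close as the previous point, which
    already belongs to the target set. *)
Lemma joining_step_decr A B x b :
  alternating_projections A B x b -> A (x 0%N) ->
  forall k, enorm (joining x b k.+2 - joining x b k.+1)
            <= enorm (joining x b k.+1 - joining x b k).
Proof.
move=> xb A0 k; have inAB := alternating_projections_in _ _ _ _ xb A0.
rewrite -(odd_double_half k); case: (odd k); rewrite ?add0n ?add1n.
- rewrite -doubleS joining_even !joining_odd.
  have [[_ min] _] := xb k./2.+1; rewrite (enorm_distC (x _)).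
  by apply: min; exact: (inAB _).2.
- rewrite -doubleS !joining_even joining_odd (enorm_distC (b _)).
  by have [_ [_ min]] := xb k./2; apply: min; exact: (inAB _).1.
Qed.

(** Both interleaved subsequences converge to [l]. *)
Lemma joining_cvg A B x b l :
  closed A -> closed B ->
  alternating_projections A B x b -> A (x 0%N) ->
  joining x b @ \oo --> l -> (A `&` B) l.
Proof.
move=> Acl Bcl xb A0 zl; have inAB := alternating_projections_in _ _ _ _ xb A0.
have sub f : (forall k, (k <= f k)%N) -> joining x b \o f @ \oo --> l.
  move=> fk; apply: cvg_comp zl => D [N _ ND]; exists N => // k /= Nk.
  exact: ND (leq_trans Nk (fk k)).
split.
- apply: (closed_cvg _ Acl _ _ (sub double _)) => [|k]; last first.
    by rewrite -addnn leq_addr.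
  by apply: nearW => k /=; rewrite joining_even; exact: (inAB k).1.
- apply: (closed_cvg _ Bcl _ _ (sub (fun k => k.*2.+1) _)) => [|k]; last first.
    by rewrite leqW// -addnn leq_addr.
  by apply: nearW => k /=; rewrite joining_odd; exact: (inAB k).2.
Qed.

(** The constant is [2 * (n - 1) + 2 * n / (1 - c)]: a head of [2 * j] steps,
    where [j <= n - 1], followed by blocks of [2 * n] steps. *)
Lemma joining_length_le {Lambda A B x b} {n j : nat} {c : R} :
  alternating_projections A B x b -> A (x 0%N) -> (j < n)%N ->
  linear_extension Lambda (fun k => joining x b (2 * j + k)%N)
    (fun k => x (j + n * k)%N) (2 * n)%N c ->
  forall N, \sum_(i < N) enorm (joining x b i.+1 - joining x b i)
    <= 2 * ((2 * n)%:R - 1 - c * (n%:R - 1)) / (1 - c) * enorm (b 0%N - x 0%N).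
Proof.
move=> xb A0 jn [[n0 /andP[c0 c1]] _ _ _ rate] N.
pose u i := enorm (joining x b i.+1 - joining x b i).
have u0 i : 0 <= u i by exact: enorm_ge0.
have udecr i : u i.+1 <= u i by exact: joining_step_decr xb A0 i.
have ule i : u i <= u 0%N by elim: i => // i; exact: le_trans.
have tail : (1 - c) * \sum_(i < N) u (2 * j + i)%N <= (2 * n)%:R * u 0%N.
  apply: le_trans (ler_wpM2l (ler0n _ _) (ule (2 * j)%N)).
  rewrite -[in leRHS](addn0 (2 * j)%N).
  apply: (sum_geometric_blocks (fun i => u (2 * j + i)%N)) => //;
    last exact: ltW.
    by move=> k; rewrite addnS.
  by move=> k; have := rate k; rewrite !addnS.
have head : \sum_(i < 2 * j) u i <= (2 * j)%:R * u 0%N.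
  rewrite -[(2 * j)%N in X in _ <= X]card_ord mulr_natl -sumr_const.
  by apply: ler_sum => i _; exact: ule.
have tot : \sum_(i < N) u i <=
    \sum_(i < 2 * j) u i + \sum_(i < N) u (2 * j + i)%N.
  apply: (@le_trans _ _ (\sum_(i < N + 2 * j) u i)).
    by rewrite big_split_ord /= lerDl sumr_ge0.
  by rewrite addnC big_split_ord.
have u0E : enorm (b 0%N - x 0%N) = u 0%N by [].
have jn' : (j.+1)%:R <= n%:R :> R by rewrite ler_nat.
rewrite u0E mulrAC ler_pdivlMr ?subr_gt0// -subr_ge0.
have c1' : 0 <= 1 - c by lra.
have := ler_wpM2l c1' tot; have := ler_wpM2l c1' head.
(* Half of the slack lost when the head of [2 * j] steps is replaced by one of
   [2 * (n - 1)] steps, after multiplication by [1 - c]. *)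
have : 0 <= (1 - c) * (n%:R - j.+1%:R) * u 0%N.
  by rewrite !mulr_ge0 ?subr_ge0 ?(ltW c1).
rewrite -natr1 !natrM; lra.
Qed.

End AlternatingProjections.

(** * Subtransversality from linear extendability *)

Theorem theorem4p16 (R : realType) (d : nat) (Lambda A B : set 'rV[R]_d)
    (xbar : 'rV[R]_d) (n : nat) (c : R) :
  closed Lambda -> closed A -> closed B ->
  (A `&` B `&` Lambda) xbar ->
  (1 <= n)%N -> 0 <= c < 1 ->
  (exists2 rho : R, 0 < rho &
    forall x b : nat -> 'rV[R]_d,
      alternating_projections A B x b ->
      A (x 0%N) -> Lambda (x 0%N) -> enorm (x 0%N - xbar) < rho ->
      exists2 j : nat, (j < n)%N &
        linear_extension Lambda (fun k => joining x b (2 * j + k)%N)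
          (fun k => x (j + n * k)%N) (2 * n)%N c) ->
  subtransversal Lambda A B xbar /\
  (sr' Lambda A B xbar <=
    (2 * ((2 * n)%:R - 1 - c * (n%:R - 1)) / (1 - c))%:E)%E.
Proof.
set kappa := 2 * _ / _.
move=> Lcl Acl Bcl [[Axb Bxb] Lxb] n0 c01 [rho rho0 ext].
have [c0 c1] := andP c01.
have A0 : A !=set0 by exists xbar.
have B0 : B !=set0 by exists xbar.
have kappa0 : 0 <= kappa.
  have n1 : 1 <= n%:R :> R by rewrite ler1n.
  by rewrite divr_ge0 ?mulr_ge0 ?natrM//; nra.
have sub : subtransversal_ineq Lambda A B xbar kappa.
  exists rho => // y Ay yrho Ly.
  have [x [b [x0 xb]]] := alternating_projections_exists A B y Acl Bcl A0 B0.
  rewrite -x0 in Ay yrho Ly *.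
  have [j jn lin] := ext x b xb Ay Ly yrho.
  have [l zl lK] := cvg_of_finite_length _ _ (joining_length_le xb Ay jn lin).
  have [Al Bl] := joining_cvg _ _ _ _ _ Acl Bcl xb Ay zl.
  have Ll : Lambda l.
    have [_ [zL _] _ _ _] := lin.
    apply: (closed_cvg _ Lcl _ _ zl); exists (2 * j)%N => // k /= jk.
    by have := zL (k - 2 * j)%N; rewrite /= subnKC.
  apply: (@le_trans _ _ (enorm (x 0%N - l))); first exact: dist_le.
  apply: le_trans lK _; rewrite ler_wpM2l//.
  exact: projector_le_dist (proj1 (xb 0%N)).
split; first by exists kappa.
by apply: ereal_inf_lbound; exists kappa.
Qed.
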